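(* Let $G$ be a finite group and let $V$ be a finite $G$-module such that $G$ possesses a regular orbit on $V$. Let $v\in V$ be a representative of such an orbit, i.e. $C_G(v)=1$. Then $$k(GV,v)\leq |V|-|G|+k(G).$$
   Context: A finite $G$-module here is a finite vector space over a field of prime characteristic $p$ on which $G$ acts linearly; no coprimeness of $|G|$ and $|V|$ is assumed. $GV$ denotes the semidirect product of $V$ by $G$ with respect to this action, $C_G(v)$ is the stabilizer of $v$ in $G$, and $k(X)$ is the number of conjugacy classes of a finite group $X$. For a finite group $X$ and $x\in X$, $\mathrm{Irr}(X,x)$ is the set of all irreducible complex characters $\chi\in\mathrm{Irr}(X)$ such that the restriction $\chi|_{\langle x\rangle}$ is not an integer multiple of the regular character of $\langle x\rangle$, and $k(X,x)=|\mathrm{Irr}(X,x)|$. *)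

(* Defs.v *)
Set Warnings "-notation-overridden,-ambiguous-paths".
From mathcomp Require Import all_boot all_order all_algebra all_fingroup.
From mathcomp Require Import all_solvable all_field all_character.

Set Implicit Arguments.
Unset Strict Implicit.
Unset Printing Implicit Defensive.

Import Order.TTheory GRing.Theory Num.Theory.
Import GroupScope.
Local Open Scope ring_scope.

Section ClassNumbers.
Variables (gT : finGroupType) (X : {group gT}).

Definition class_number : nat := #|classes X|.

(* Irr(X, x), as a set of indices: i : Iirr X stands for the irreducible
   character 'chi_i.  'Z[S] is the set of Z-linear combinations of S, so for
   S = [:: rho] it is the set of integer multiples of rho (see
   zchar_seq1P).  This is meant for x \in X: otherwise <[x]> is not contained
   in X and 'Res is not a restriction. *)
Definition Irr_at (x : gT) : {set Iirr X} :=
  [set i | 'Res[<[x]>] 'chi[X]_i \notin 'Z[[:: cfReg <[x]>]]].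

Definition class_number_at (x : gT) : nat := #|Irr_at x|.

End ClassNumbers.

Lemma zchar_seq1P (gT : finGroupType) (H : {group gT}) (phi rho : 'CF(H)) :
  reflect (exists z : int, phi = rho *~ z) (phi \in 'Z[[:: rho]]).
Proof.
apply: (iffP idP) => [/andP[_ /sumboolP[a ->]] | [z ->]].
  by exists (a ord0); rewrite big_ord1.
by rewrite rpredMz // mem_zchar // mem_head.
Qed.

Lemma Irr_atP (gT : finGroupType) (X : {group gT}) (x : gT) (i : Iirr X) :
  reflect (~ exists z : int, 'Res[<[x]>] 'chi[X]_i = cfReg <[x]> *~ z)
          (i \in Irr_at X x).
Proof. by rewrite inE; apply: (iffP negP) => h /zchar_seq1P. Qed.

Section SemidirectProduct.
Variables (F : fieldType) (V : finLmodType F).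
Variables (gT : finGroupType) (G : {group gT}).

(* A groupAction on [set: V] acts by automorphisms of the additive group of
   V, that is, additively. *)
Definition linear_action (to : groupAction G [set: V]) : Prop :=
  {in G, forall g, linear (fun u : V => to u g)}.

Variable to : groupAction G [set: V].

Definition GV : {group sdprod_by to} := [set: sdprod_by to]%G.

(* The vector v as an element of GV. *)
Definition vecGV (v : V) : sdprod_by to := sdpair1 to v.

End SemidirectProduct.

(* Main.v *)
(* Let x = v, of order p (v <> 0). Column orthogonality, summed over the p - 1
   nontrivial powers y of x, gives
     sum_chi sum_y |chi y|^2 = sum_y #|C_GV(y)| <= (p - 1) #|V|,
   because C_GV(x) = V when C_G(v) = 1. The characters with V in their kernel are
   those of G: there are k(G) of them and they contribute (p - 1) #|G|. Any other
   character of Irr(GV, v) contributes at least p - 1: if a_1, .., a_p are the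
   multiplicities of the linear characters of <x> in its restriction, then
   sum_y |chi y|^2 = p sum a_i^2 - (sum a_i)^2 = sum_(i < j) (a_i - a_j)^2, which
   is at least p - 1 unless all the a_i coincide. *)
Require Import Defs.
From mathcomp Require Import all_boot all_order all_algebra all_fingroup.
From mathcomp Require Import all_solvable all_field all_character.
From mathcomp Require Import ring zify.

Set Implicit Arguments.
Unset Strict Implicit.
Unset Printing Implicit Defensive.

Import Order.TTheory GRing.Theory Num.Theory.
Import GroupScope.
Local Open Scope ring_scope.

(** Lets the defect in the Cauchy-Schwarz inequality be bounded below by counting pairs of unequal
    values. *)
Lemma sum_sqr_diff (R : comPzRingType) (I : finType) (a : I -> R) :
  \sum_i \sum_j (a i - a j) ^+ 2
    = (#|I|%:R * (\sum_i a i ^+ 2) - (\sum_i a i) ^+ 2) *+ 2.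
Proof.
have inner i : \sum_j (a i - a j) ^+ 2
    = a i ^+ 2 *+ #|I| - (a i * \sum_j a j) *+ 2 + \sum_j a j ^+ 2.
  under eq_bigr do rewrite sqrrB.
  by rewrite big_split /= sumrB sumr_const sumrMnl -mulr_sumr.
under eq_bigr do rewrite inner.
rewrite big_split /= sumrB !sumrMnl sumr_const -mulr_suml -(mulr_natl _ #|I|).
by ring.
Qed.

(* At least 2 * m * n >= 2 * (m + n - 1) of the ordered pairs have distinct values,
   where m indices share the value of i and n do not. *)
Lemma ler_card_sqr_diff (I : finType) (a : I -> int) (i j : I) :
  a i != a j ->
  #|I|%:R - 1 <= #|I|%:R * (\sum_k a k ^+ 2) - (\sum_k a k) ^+ 2.
Proof.
move=> aij; pose A := [pred k | a k == a i].
suff: (#|I|%:R - 1) *+ 2 <= \sum_k \sum_l (a k - a l) ^+ 2.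
  by rewrite sum_sqr_diff lerMn2r.
have cA : (#|A| + #|predC A| = #|I|)%N by rewrite cardC.
have A_gt0 : (0 < #|A|)%N by apply/card_gt0P; exists i; rewrite inE /=.
have CA_gt0 : (0 < #|predC A|)%N.
  by apply/card_gt0P; exists j; rewrite !inE eq_sym.
(* Integrality enters here: the square of a nonzero integer is at least 1. *)
have le_kl k l : ((k \in A) != (l \in A))%:R <= (a k - a l) ^+ 2.
  rewrite !inE; case: (eqVneq (a k) (a l)) => [->|]; first by rewrite eqxx sqr_ge0.
  move=> kl; apply: (@le_trans _ _ 1); first by case: (_ != _).
  by rewrite -gtz0_ge1 exprn_even_gt0 ?subr_eq0.
apply: le_trans (_ : \sum_k \sum_l ((k \in A) != (l \in A))%:R <= _); last first.
  by apply: ler_sum => k _; apply: ler_sum.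
rewrite (bigID [in A]) /=.
rewrite (eq_bigr (fun=> #|predC A|%:R)); last first.
  move=> k ->; rewrite -sumr_const [RHS]big_mkcond /=.
  by apply: eq_bigr => l _; rewrite !inE; case: (a l == a i).
rewrite [X in _ <= _ + X](eq_bigr (fun=> #|A|%:R)); last first.
  move=> k /negPf->; rewrite -sumr_const [RHS]big_mkcond /=.
  by apply: eq_bigr => l _; rewrite !inE; case: (a l == a i).
rewrite !sumr_const -/(predC A).
have -> : #|[pred k | k \notin A]| = #|predC A| by apply: eq_card.
rewrite -cA natrD -(mulr_natl #|predC A|%:R #|A|)
  -(mulr_natl #|A|%:R #|predC A|).
move: A_gt0 CA_gt0; rewrite -!(ltr_nat int).
move: #|A|%:R #|predC A|%:R => m n m0 n0.
have: 0 <= (m - 1) * (n - 1) by rewrite mulr_ge0 // subr_ge0 -gtz0_ge1.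
have <- : (m * n + n * m) - (m - 1) * (n - 1) *+ 2 = (m + n - 1) *+ 2 by ring.
by move=> h; rewrite gerBl mulrn_wge0.
Qed.

(** With [a i] the coefficients of [phi], orthonormality gives [#|H| * \sum_i a i ^+ 2] for the sum
    over all of [H]. As [H] is abelian, [phi 1] is [\sum_i a i], so deleting [y = 1] leaves the
    quantity bounded in [ler_card_sqr_diff]. *)
Lemma vchar_sum_norm_ge (gT : finGroupType) (H : {group gT}) (phi : 'CF(H)) :
    abelian H -> phi \in 'Z[irr H]%CF -> phi \notin 'Z[[:: cfReg H]]%CF ->
  #|H|%:R - 1 <= \sum_(y in H^#) `|phi y| ^+ 2.
Proof.
move=> abH Zphi nreg.
have Za i : exists z : int, '[phi, 'chi_i] = z%:~R.
  by apply/intrP; apply: Cint_cfdot_vchar_irr.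
have [a Da] := fin_all_exists Za.
have lin1 i : 'chi[H]_i 1%g = 1 by apply/lin_char1/char_abelianP.
have phi1 : phi 1%g = (\sum_i a i)%:~R.
  rewrite {1}[phi]cfun_sum_cfdot sum_cfunE rmorph_sum /=.
  by apply: eq_bigr => i _; rewrite cfunE lin1 mulr1 Da.
have norm_phi : \sum_(y in H) `|phi y| ^+ 2 = #|H|%:R * (\sum_i a i ^+ 2)%:~R.
  have -> : (\sum_i a i ^+ 2)%:~R = '[phi].
    rewrite cfdot_sum_irr rmorph_sum /=; apply: eq_bigr => i _.
    by rewrite Da rmorphXn /= -normCK real_normK ?realz.
  rewrite cfdotE mulVKf ?neq0CG //; apply: eq_bigr => y _.
  by rewrite normCK.
(* [cfReg H] contains each linear character exactly once, so equal coefficients would make [phi] an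
   integer multiple of it. *)
have [/forallP a_const | /forallPn[i]] := boolP [forall i, a i == a 0].
  case/zchar_seq1P: nreg; exists (a 0); rewrite cfReg_sum.
  rewrite {1}[phi]cfun_sum_cfdot -scaler_int scaler_sumr; apply: eq_bigr => i _.
  by rewrite Da lin1 scale1r (eqP (a_const i)).
move/ler_card_sqr_diff; rewrite card_Iirr_abelian //.
rewrite -(ler_int algC) !rmorphB rmorphM /= !rmorph_nat -norm_phi rmorphXn /=.
by rewrite (big_setD1 1%g) //= phi1 real_normK ?realz // [X in _ <= X - _ -> _]addrC addrK.
Qed.

Lemma sum_irr_sqr_norm (gT : finGroupType) (X : {group gT}) (x : gT) :
  x \in X -> \sum_i `|'chi[X]_i x| ^+ 2 = #|'C_X[x]|%:R.
Proof.
move=> Xx; under eq_bigr do rewrite normCK.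
by rewrite second_orthogonality_relation // class_refl.
Qed.

Lemma sum_irr1_sqr_quo (gT : finGroupType) (X N : {group gT}) : N <| X ->
  \sum_(i | N \subset cfker 'chi[X]_i) `|'chi_i 1%g| ^+ 2 = #|X : N|%:R.
Proof.
move=> nNX; rewrite -sum_norm_irr_quo ?group1 // morph1 sum_irr_sqr_norm //.
by rewrite cent11T setIT card_quotient ?normal_norm.
Qed.

Lemma card_cfker_quo (gT : finGroupType) (X N : {group gT}) : N <| X ->
  #|[set i | N \subset cfker 'chi[X]_i]| = #|classes (X / N)|.
Proof.
move=> nNX; rewrite -NirrE -[RHS]card_ord -!sum1_card.
rewrite (eq_bigl (fun i => N \subset cfker 'chi_i)) => [|i]; last by rewrite inE.
rewrite (reindex _ (mod_Iirr_bij nNX)) /=.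
by apply: eq_bigl => i; rewrite mod_IirrE // cfker_mod.
Qed.

(** The regular character of the trivial group is the constant 1, so every restriction is an integer
    multiple of it. This settles the case [v = 0]. *)
Lemma class_number_at1 (gT : finGroupType) (X : {group gT}) :
  class_number_at X 1 = 0%N.
Proof.
apply: eq_card0 => i; apply/Irr_atP; case.
have /natrP[n chi1] := Cnat_irr1 i.
exists n; apply/cfun_inP => y y1.
rewrite cfResE ?cycle_subG ?group1 //.
have {y1} -> : y = 1%g by apply/set1gP; rewrite -cycle1.
by rewrite chi1 -scaler_int cfunE cfRegE eqxx -orderE order1 mulr1.
Qed.

(* If N is not in the kernel of 'chi_i and i \in Irr_at X x, the norms on <[x]>^#
   sum to at least #|<[x]>^#|; if N is in the kernel they are all 'chi_i 1. *)
Lemma class_number_at_normal (gT : finGroupType) (X N : {group gT})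
    (x : gT) (c : nat) :
    N <| X -> x \in N -> x != 1%g ->
    {in <[x]>^#, forall y, #|'C_X[y]| <= c}%N ->
  (class_number_at X x + #|X : N| <= c + class_number (X / N))%N.
Proof.
move=> nNX Nx ntx leC; have sNX := normal_sub nNX.
have sxN : <[x]> \subset N by rewrite cycle_subG.
have sxX := subset_trans sxN sNX.
set K := [set i | N \subset cfker 'chi[X]_i].
have cardK : #|K| = class_number (X / N) by apply: card_cfker_quo.
set D := Irr_at X x :\: K.
(* At most [#|K|], the class number of [X / N], members of [Irr_at X x] lie outside [D]. *)
suff leD : (#|X : N| + #|D| <= c)%N.
  have : (class_number_at X x <= #|K| + #|D|)%N.
    rewrite /class_number_at -(cardsID K (Irr_at X x)) leq_add //.
    by rewrite subset_leq_card ?subsetIr.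
  rewrite -cardK; lia.
have cardx : #|<[x]>^#| = #|<[x]>|.-1 by rewrite (cardsD1 1%g <[x]>) group1.
have x_gt0 : (0 < #|<[x]>^#|)%N.
  by apply/card_gt0P; exists x; rewrite !inE ntx cycle_id.
rewrite -(leq_pmul2l x_gt0) -(ler_nat algC) natrM natrD.
pose S i := \sum_(y in <[x]>^#) `|'chi[X]_i y| ^+ 2.
have S_ge0 i : 0 <= S i by apply: sumr_ge0 => y _; rewrite exprn_ge0.
(* Double counting: with the sums exchanged, column orthogonality turns the total into the sum of
   [#|'C_X[y]|], each term at most [c]. *)
apply: le_trans (_ : \sum_i S i <= _); last first.
  rewrite exchange_big /= mulnC natrM -sum1_card natr_sum mulr_sumr.
  apply: ler_sum => y xy; rewrite mulr1 sum_irr_sqr_norm ?ler_nat ?leC //.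
  by apply: (subsetP sxX); case/setD1P: xy.
rewrite (bigID [in K]) /= mulrDr lerD //.
  rewrite -sum_irr1_sqr_quo // mulr_sumr.
  rewrite (eq_bigl [in K]) => [|i]; last by rewrite inE.
  apply: ler_sum => i; rewrite inE => kerN.
  rewrite mulr_natl -sumr_const; apply: ler_sum => y /setD1P[_ xy].
  by rewrite cfker1 // (subsetP kerN) // (subsetP sxN).
apply: le_trans (_ : \sum_(i in D) S i <= _); last first.
  rewrite [leLHS]big_mkcond [leRHS]big_mkcond ler_sum // => i _.
  by rewrite inE; case: (i \in K) => //=; case: ifP.
rewrite mulr_natr -sumr_const; apply: ler_sum => i /setDP[Di _].
rewrite in_set in Di.
have := vchar_sum_norm_ge (cycle_abelian x) (cfRes_vchar _ (irr_vchar i)) Di.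
rewrite /S cardx -subn1 natrB // => /le_trans; apply.
by apply: ler_sum => y /setD1P[_ xy]; rewrite cfResE.
Qed.

Section RegularOrbit.
Variables (F : fieldType) (V : finLmodType F).
Variables (gT : finGroupType) (G : {group gT}) (to : groupAction G [set: V]).

(** Write an element of the centralizer as a product of some [g] in [G] and [u] in [V]. Since [V] is
    abelian, [u] commutes with [v]; hence so does [g], and regularity forces [g = 1]. *)
Lemma cent_vecGV_sub (v : V) : 'C_G[v | to] = 1%g ->
  'C[vecGV to v] \subset sdpair1 to @* [set: V].
Proof.
move=> reg_v; apply/subsetP=> z /cent1P cz.
have : z \in (sdpair2 to @* G * sdpair1 to @* [set: V])%g.
  by rewrite (normC (im_sdpair_norm to)) im_sdpair.
case/mulsgP=> _ _ /morphimP[g _ Gg ->] /morphimP[u _ _ ->] Dz.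
suff g1 : g = 1%g by rewrite Dz g1 morph1 mul1g mem_morphim ?inE.
apply/set1gP; rewrite -reg_v !inE Gg sub1set inE; apply/eqP.
apply: (injmP (injm_sdpair1 to)); rewrite ?in_setT //=.
rewrite sdpair_act ?in_setT //.
have cuv : commute (sdpair1 to u) (vecGV to v).
  by rewrite /commute -!sdpair1_morphM ?in_setT // !FinRing.zmodMgE addrC.
have -> : sdpair2 to g = (z * (sdpair1 to u)^-1)%g by rewrite Dz mulgK.
rewrite conjgE; apply/(canLR (mulKg _)).
exact: commuteM (commute_sym cz) (commuteV (commute_sym cuv)).
Qed.

End RegularOrbit.

Theorem theorem2p2
    (gT : finGroupType) (G : {group gT})
    (p : nat) (F : fieldType) (charF : p \in [pchar F])
    (V : finLmodType F)
    (to : groupAction G [set: V]) (lin_to : linear_action to)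
    (v : V) (regular_v : 'C_G[v | to] = 1%g) :
  (class_number_at (GV to) (vecGV to v))%:Z
    <= #|V|%:Z - #|G|%:Z + (class_number G)%:Z.
Proof.
have pr_p := pcharf_prime charF.
set x := vecGV to v; pose N := (sdpair1 to @* [set: V])%G.
have defX := sdprod_sdpair to.
have isoN : G \isog (GV to / N)%g.
  by apply: isog_trans (sdprod_isog defX); rewrite sub_isog ?injm_sdpair2.
have nNX : N <| GV to by case/sdprod_context: defX.
have Nx : x \in N by rewrite mem_morphim ?inE.
have cardN : #|N| = #|V| by rewrite card_injm ?injm_sdpair1 // cardsT.
have index_N : #|GV to : N| = #|G|.
  by rewrite -card_quotient ?normal_norm // (card_isog isoN).
have class_quo : class_number (GV to / N) = class_number G.
  by rewrite /class_number (nclasses_isog isoN).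
have xp : (x ^+ p)%g = 1%g.
  rewrite /x /vecGV -morphX ?in_setT // FinRing.zmodXgE -scaler_nat (pcharf0 charF) scale0r.
  exact: morph1.
suff : (class_number_at (GV to) x + #|G| <= #|V| + class_number G)%N by lia.
have [-> | ntx] := eqVneq x 1%g.
  (* Here [v = 0] and the left side vanishes; the regular orbit has [#|G|] elements, so
     [#|G| <= #|V|]. *)
  rewrite class_number_at1 add0n (leq_trans _ (leq_addr _ _)) //.
  by rewrite -[#|G|](indexg1 G) -regular_v -card_orbit_in // max_card.
rewrite -index_N -class_quo; apply: class_number_at_normal => // y /setD1P[nty xy].
(* Primality of [p] makes every nontrivial power [y] a generator of [<[x]>], so [y] and [x] have the
   same centralizer. *)
have ox : #[x] = p by apply: nt_prime_order.
have oy : #[y] = p.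
  by apply: nt_prime_order => //; case/cycleP: xy => k ->; rewrite expgAC xp expg1n.
have yx : <[y]> = <[x]>.
  by apply/eqP; rewrite eqEcard cycle_subG xy -!orderE ox oy /=.
rewrite -cardN subset_leq_card // setTI -cent_cycle yx cent_cycle.
exact: cent_vecGV_sub.
Qed.
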